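(* Let $\mathcal H$ be a finite-dimensional complex Hilbert space, let $\mathbf g_{\mathrm{pri}}$ be a real Lie algebra of skew-Hermitian operators on $\mathcal H$, and let $H_{\mathrm{pert}}$ be a Hermitian operator on $\mathcal H$. Put $e^{\mathbf g_{\mathrm{pri}}}=\{e^{g}\mid g\in\mathbf g_{\mathrm{pri}}\}$ and define $$\mathscr C(\mathbf g_{\mathrm{pri}},H_{\mathrm{pert}})=\operatorname{span}_{\mathbb R}\bigl\{[g_1,[g_2,\cdots[g_L,H_{\mathrm{pert}}]\cdots]]\ \big|\ L\ge 0,\ g_1,\dots,g_L\in\mathbf g_{\mathrm{pri}}\bigr\},$$ $$\mathscr O(\mathbf g_{\mathrm{pri}},H_{\mathrm{pert}})=\operatorname{span}_{\mathbb R}\bigl\{U^\dagger H_{\mathrm{pert}}U\ \big|\ U\in e^{\mathbf g_{\mathrm{pri}}}\bigr\}.$$ Then $\mathscr C(\mathbf g_{\mathrm{pri}},H_{\mathrm{pert}})=\mathscr O(\mathbf g_{\mathrm{pri}},H_{\mathrm{pert}})$.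
   Context: $[A,B]=AB-BA$. The term with $L=0$ in the definition of $\mathscr C$ is $H_{\mathrm{pert}}$ itself. In the application, $\mathbf g_{\mathrm{pri}}$ is the real Lie algebra generated by the operators $iH_j$, where $\{H_j\}$ is a (Hermitian) basis of the minimal operator subspace containing all values of the primary Hamiltonian $H_{\mathrm{pri}}(t)$. Both $\mathscr C$ and $\mathscr O$ are real subspaces of the space of Hermitian operators on $\mathcal H$. *)

(* Defs.v *)
(* The complex numbers are R[i] for R : realType, and a
   finite-dimensional complex Hilbert space is a V : vectType R[i] with a
   positive definite Hermitian form (completeness is automatic). *)
From HB Require Import structures.
From mathcomp Require Import all_boot all_order all_algebra.
From mathcomp Require Import complex.
From mathcomp Require Import all_classical all_reals all_analysis.
Export numFieldNormedType.Exports.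

Set Implicit Arguments.
Unset Strict Implicit.
Unset Printing Implicit Defensive.

Import Order.TTheory GRing.Theory Num.Theory Num.Def.

Local Open Scope classical_set_scope.
Local Open Scope complex_scope.
Local Open Scope ring_scope.

Definition real_span (R : realType) (W : lmodType R[i]) (S : set W) : set W :=
  [set x | exists (n : nat) (c : 'I_n -> R) (y : 'I_n -> W),
     (forall k, S (y k)) /\ x = \sum_(k < n) (c k)%:C *: y k].

Section Operators.
Variables (R : realType) (V : vectType R[i]).
Implicit Types (A B H E X Y : 'End(V)) (g : set 'End(V)).

Definition commutator A B : 'End(V) := (A \o B)%VF - (B \o A)%VF.

Definition real_lie_algebra g : Prop :=
  [/\ g 0,
      forall X Y, g X -> g Y -> g (X + Y),
      forall (c : R) X, g X -> g (c%:C *: X) &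
      forall X Y, g X -> g Y -> g (commutator X Y)].

(* foldr commutator H [:: X1; ...; XL] is [X1, [X2, ... [XL, H] ... ]],
   and it is H itself for the empty sequence. *)
Definition commutator_space g H : set 'End(V) :=
  real_span [set foldr commutator H s | s in
    [set s : seq 'End(V) | forall X, X \in s -> g X]].

Definition exp_partial_sum X (n : nat) : 'End(V) :=
  \sum_(k < n) (k`!%:R : R[i])^-1 *: iter k (comp_lfun X) \1%VF.

Variable form : {dot V for conjC}.

Definition is_adjoint A B : Prop :=
  forall u v : V, form (A u) v = form u (B v).

Definition hermitian_op A : Prop := is_adjoint A A.

Definition skew_hermitian_op A : Prop := is_adjoint A (- A).

(* form v v is real, so nothing is lost by taking its real part. *)
Definition hnorm (v : V) : R := sqrtr (complex.Re (form v v)).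

(* E = e^X as the sum of the exponential series.  Convergence is pointwise on V;
   since V is finite-dimensional, this is convergence in operator norm. *)
Definition is_exp X E : Prop :=
  forall v : V, hnorm (exp_partial_sum X n v - E v) @[n --> \oo] --> (0 : R).

Definition exp_set g : set 'End(V) :=
  [set E | exists2 X, g X & is_exp X E].

Definition orbit_space g H : set 'End(V) :=
  real_span [set A | exists U Udag : 'End(V),
    [/\ exp_set g U, is_adjoint U Udag & A = (Udag \o (H \o U))%VF]].

End Operators.

(* Main.v *)
From HB Require Import structures.
Require Import Defs.
From mathcomp Require Import all_boot all_order all_algebra.
From mathcomp Require Import complex ring zify.
From mathcomp Require Import all_classical all_reals all_analysis.

(** In finite dimension, the real span of a set consists of the common zeros of
    the real-linear functionals [phi] that vanish on the set, so both inclusions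
    amount to showing that [phi] kills one family of generators when it kills the
    other.  For [X] in the Lie algebra, [e^X] has adjoint [e^-X] and
    [e^-X H e^X] is the sum of [ad(-X)^k H / k!], which gives one inclusion at
    once.  Conversely, if [phi] kills [e^(-tX) H e^(tX)] for all real [t], it
    kills every coefficient [ad(X)^k H] of that power series in [t].  Modulo
    shorter words, [phi (ad(X1) ... ad(XL) H)] is a symmetric multilinear
    function of [X1, ..., XL], by the Jacobi identity; it vanishes on the
    diagonal, hence everywhere by polarization, and one concludes by induction
    on the length [L].  In
    particular the set of exponentials need not be a group. *)

Set Implicit Arguments.
Unset Strict Implicit.
Unset Printing Implicit Defensive.

Import Order.TTheory GRing.Theory Num.Theory Num.Def.

Local Open Scope classical_set_scope.
Local Open Scope complex_scope.
Local Open Scope ring_scope.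

(** * Real-linear functionals *)

Definition real_linear (R : realType) (W : lmodType R[i]) (phi : W -> R) :=
  forall (c : R) x y, phi (c%:C *: x + y) = c * phi x + phi y.

Section RealLinear.
Variables (R : realType) (W : lmodType R[i]) (phi : W -> R).
Hypothesis phi_lin : real_linear phi.

Lemma real_linear0 : phi 0 = 0.
Proof.
have := phi_lin 1 0 0; rewrite scaler0 addr0 mul1r => /eqP.
by rewrite -subr_eq subrr => /eqP.
Qed.

Lemma real_linearD x y : phi (x + y) = phi x + phi y.
Proof. by have := phi_lin 1 x y; rewrite scale1r mul1r. Qed.

Lemma real_linearZ c x : phi (c%:C *: x) = c * phi x.
Proof. by have := phi_lin c x 0; rewrite !addr0 real_linear0 addr0. Qed.

Lemma real_linearN x : phi (- x) = - phi x.
Proof. by rewrite -scaleN1r -(mulN1r (phi x)) -real_linearZ rmorphN rmorph1. Qed.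

Lemma real_linearB x y : phi (x - y) = phi x - phi y.
Proof. by rewrite real_linearD real_linearN. Qed.

Lemma real_linear_sum I (r : seq I) (P : pred I) (F : I -> W) :
  phi (\sum_(i <- r | P i) F i) = \sum_(i <- r | P i) phi (F i).
Proof. exact: (big_morph phi real_linearD real_linear0). Qed.

Lemma real_linear_comp (W' : lmodType R[i]) (f : W' -> W) :
  linear f -> real_linear (phi \o f).
Proof. by move=> f_lin c x y; rewrite /= f_lin phi_lin. Qed.

Lemma real_linear_span (S : set W) x :
  (forall s, S s -> phi s = 0) -> real_span S x -> phi x = 0.
Proof.
move=> S0 [n [c [y [Sy ->]]]]; rewrite real_linear_sum big1 // => k _.
by rewrite real_linearZ S0 ?mulr0.
Qed.

End RealLinear.

(** * Real coordinates and separation by functionals *)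

Section RealBasis.
Variables (R : realType) (W : vectType R[i]).

(** A complex basis together with its multiples by ['i] spans over the reals, with the real and
    imaginary parts of the complex coordinates as coefficients. *)
Lemma real_basis : exists (I : finType) (e : I -> W) (f : I -> W -> R),
  (forall i, real_linear (f i)) /\ forall w, w = \sum_i (f i w)%:C *: e i.
Proof.
pose b := vbasis {:W}.
pose e (i : 'I_(\dim {:W}) * bool) := if i.2 then b`_i.1 else 'i *: b`_i.1.
pose f (i : 'I_(\dim {:W}) * bool) w :=
  if i.2 then complex.Re (coord b i.1 w) else complex.Im (coord b i.1 w).
exists ('I_(\dim {:W}) * bool)%type, e, f; split.
  by move=> [i [|]] c x y; rewrite /f /= linearP /=;
    case: (coord b i x) (coord b i y) => [? ?] [? ?] /=; rewrite mul0r ?subr0 ?addr0.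
move=> w; rewrite {1}(coord_vbasis (memvf w)).
rewrite -(pair_bigA _ (fun i j => (f (i, j) w)%:C *: e (i, j))) /=.
apply: eq_bigr => i _; rewrite big_bool /f /e /= scalerA -scalerDl.
by rewrite {1}[coord _ _ _]complexE mulrC.
Qed.

(** Duality by matrices: the coordinate rows of a largest free family in [S] form a matrix [B] whose
    row space contains all of [S], and the columns of [cokermx B] are functionals whose common zeros
    are exactly that row space. *)
Lemma real_span_separation (S : set W) x :
  (forall phi : W -> R, real_linear phi -> (forall s, S s -> phi s = 0) ->
    phi x = 0) -> real_span S x.
Proof.
move=> sep; have [I [e [f [f_lin fE]]]] := real_basis.
pose r w : 'rV[R]_#|I| := \row_i f (enum_val i) w.
have rP c w w' : r (c%:C *: w + w') = c *: r w + r w'.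
  by apply/rowP => i; rewrite !mxE f_lin.
have r_inj : injective r.
  move=> w w' rww'; rewrite (fE w) (fE w'); apply: eq_bigr => i _.
  by have /rowP/(_ (enum_rank i)) := rww'; rewrite !mxE enum_rankK => ->.
(* [P k] asserts that [S] contains [k] vectors with independent coordinate rows; being boolean and
   bounded by the number of coordinates, it has a largest witness. *)
pose P k := `[< exists (B : 'M[R]_(k, #|I|)) (y : 'I_k -> W),
  row_free B /\ forall i, S (y i) /\ row i B = r (y i) >].
have P0 : exists k, P k.
  exists 0%N; apply/asboolP; exists 0, (fun=> 0); split; last by case.
  by rewrite /row_free mxrank0.
have Pmax k : P k -> (k <= #|I|)%N.
  by move=> /asboolP[B [y [/eqP Bk _]]]; rewrite -Bk; exact: rank_leq_col.
case: (ex_maxnP P0 Pmax) => k /asboolP[B [y [Bfree yP]]] kmax.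
have subB s : S s -> (r s <= B)%MS.
  move=> Ss; apply/negPn/negP => nsub.
  suff /kmax : P k.+1 by rewrite ltnn.
  apply/asboolP; rewrite -addn1; exists (col_mx B (r s)).
  exists (fun i : 'I_(k + 1) =>
    match fintype.split i with inl j => y j | inr _ => s end); split.
    rewrite /row_free eqn_leq rank_leq_row /=.
    rewrite -addsmxE addn1 -{1}(eqP Bfree).
    have : (B < B + r s)%MS.
      rewrite ltmxE addsmxSl /=; apply: contra nsub.
      exact: submx_trans (addsmxSr _ _).
    by rewrite ltmxErank => /andP[].
  move=> i; case: fintype.splitP => j ij.
    have -> : i = lshift 1 j by exact: val_inj.
    by rewrite rowKu; exact: yP.
  have -> : i = rshift k j by exact: val_inj.
  by rewrite rowKd row_id.
have : (r x <= B)%MS.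
  rewrite submxE; apply/eqP/rowP => j; rewrite [RHS]mxE.
  (* Column [j] of the cokernel, read as a real-linear functional, kills [S], hence [x]. *)
  pose phi w := (r w *m cokermx B) 0 j.
  apply: (sep phi) => [c w w'|s /subB].
    by rewrite /phi rP mulmxDl -scalemxAl !mxE.
  by rewrite /phi submxE => /eqP ->; rewrite mxE.
move=> /submxP[D rxE]; exists k, (D 0), y; split; first by move=> i; case: (yP i).
apply: r_inj; rewrite rxE; apply/rowP => j.
rewrite !mxE real_linear_sum //; apply: eq_bigr => i _.
rewrite real_linearZ //; have [_ /rowP/(_ j)] := yP i.
by rewrite !mxE => ->.
Qed.

End RealBasis.

(** * Weak convergence *)

Lemma cvgr_sum (R : realType) (I : Type) (r : seq I) (F : I -> nat -> R)
    (l : I -> R) :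
  (forall i, F i n @[n --> \oo] --> l i) ->
  \sum_(i <- r) F i n @[n --> \oo] --> \sum_(i <- r) l i.
Proof.
move=> Fl; elim: r => [|i r IH].
  by rewrite big_nil; under eq_fun do rewrite big_nil; exact: cvg_cst.
by rewrite big_cons; under eq_fun do rewrite big_cons; exact: cvgD.
Qed.

(* In finite dimension this is convergence for any norm; quantifying over all
   functionals spares the choice of one. *)
Definition weak_cvg (R : realType) (W : lmodType R[i]) (u : nat -> W) (l : W) :=
  forall phi : W -> R, real_linear phi -> phi (u n) @[n --> \oo] --> phi l.

Section WeakConvergence.
Variable R : realType.

Lemma weak_cvg_comp (W W' : lmodType R[i]) (f : W -> W') u l :
  linear f -> weak_cvg u l -> weak_cvg (f \o u) (f l).
Proof.
by move=> f_lin ul phi phi_lin; exact: (ul _ (real_linear_comp phi_lin f_lin)).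
Qed.

(** Expanding both arguments in real bases turns [b] into a finite sum of products of convergent
    coordinates. *)
Lemma cvg_real_bilinear (W W' : vectType R[i]) (b : W -> W' -> R) u l u' l' :
  (forall y, real_linear (b^~ y)) -> (forall x, real_linear (b x)) ->
  weak_cvg u l -> weak_cvg u' l' -> b (u n) (u' n) @[n --> \oo] --> b l l'.
Proof.
move=> bl br ul ul'.
have [I [e [f [f_lin fE]]]] := real_basis W.
have [I' [e' [f' [f'_lin f'E]]]] := real_basis W'.
have bE x y : b x y = \sum_i \sum_j f i x * (f' j y * b (e i) (e' j)).
  rewrite {1}(fE x) (real_linear_sum (bl y)); apply: eq_bigr => i _.
  rewrite (real_linearZ (bl y)) -mulr_sumr; congr (_ * _).
  rewrite {1}(f'E y) (real_linear_sum (br (e i))).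
  by apply: eq_bigr => j _; rewrite (real_linearZ (br (e i))).
rewrite bE; under eq_fun do rewrite bE.
apply: cvgr_sum => i; apply: cvgr_sum => j.
by apply: cvgM; [exact: ul|apply: cvgMl; exact: ul'].
Qed.

Lemma weak_cvg_bilinear (W W' : vectType R[i]) (W'' : lmodType R[i])
    (B : W -> W' -> W'') u l u' l' :
  (forall y, linear (B^~ y)) -> (forall x, linear (B x)) ->
  weak_cvg u l -> weak_cvg u' l' -> weak_cvg (fun n => B (u n) (u' n)) (B l l').
Proof.
move=> Bl Br ul ul' phi phi_lin.
apply: (cvg_real_bilinear (b := fun x y => phi (B x y)) _ _ ul ul') => x.
  exact: (real_linear_comp phi_lin (Bl x)).
exact: (real_linear_comp phi_lin (Br x)).
Qed.

(** The sum of the absolute values of the real coordinates plays the part of a norm in all the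
    estimates that follow. *)
Lemma dominating_size (W : vectType R[i]) : exists N : W -> R,
  [/\ forall w, 0 <= N w,
      forall phi : W -> R, real_linear phi ->
        exists2 K, 0 <= K & forall w, `|phi w| <= K * N w &
      forall L : W -> W, linear L ->
        exists2 K, 0 <= K & forall w, N (L w) <= K * N w].
Proof.
have [I [e [f [f_lin fE]]]] := real_basis W.
pose N w := \sum_i `|f i w|.
have Nphi (phi : W -> R) : real_linear phi ->
    exists2 K, 0 <= K & forall w, `|phi w| <= K * N w.
  move=> phi_lin; exists (\sum_i `|phi (e i)|); first exact: sumr_ge0.
  move=> w; rewrite {1}(fE w) real_linear_sum //.
  apply: le_trans (ler_norm_sum _ _ _) _; rewrite mulr_sumr; apply: ler_sum => i _.
  rewrite real_linearZ // normrM mulrC ler_wpM2r //.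
  by rewrite (bigD1 i) //= lerDl sumr_ge0.
exists N; split => // [w|L L_lin]; first exact: sumr_ge0.
have /choice[K KP] i : exists K, 0 <= K /\ forall w, `|f i (L w)| <= K * N w.
  by have [K K0 KP] := Nphi _ (real_linear_comp (f_lin i) L_lin); exists K.
exists (\sum_i K i); first by apply: sumr_ge0 => i _; case: (KP i).
by move=> w; rewrite mulr_suml; apply: ler_sum => i _; case: (KP i) => _.
Qed.

Lemma iter_size_le (W : Type) (N : W -> R) (L : W -> W) K :
  0 <= K -> (forall w, N (L w) <= K * N w) ->
  forall k w, N (iter k L w) <= K ^+ k * N w.
Proof.
move=> K0 KL; elim=> [|k IH] w; first by rewrite expr0 mul1r.
by rewrite iterS exprS -mulrA; apply: le_trans (KL _) _; rewrite ler_wpM2l.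
Qed.

(** Stated for any operator so as to cover both [e^X], with [L] the left multiplication by [X] and
    [w] the identity, and the series of [commutator (- X)] at [H]. *)
Definition op_exp_sum (W : lmodType R[i]) (L : W -> W) (w : W) n :=
  \sum_(k < n) (k`!%:R^-1 : R)%:C *: iter k L w.

(** Each coordinate of the series is dominated by a multiple of the real exponential series at a
    bound [M] of [L]; the limit is assembled from the coordinate limits. *)
Lemma op_exp_sum_cvg (W : vectType R[i]) (L : W -> W) w :
  linear L -> exists l, weak_cvg (op_exp_sum L w) l.
Proof.
move=> L_lin; have [I [e [f [f_lin fE]]]] := real_basis W.
have [N [N0 Nphi NL]] := dominating_size W.
have [M M0 /(iter_size_le M0) NLk] := NL _ L_lin.
have f_sum i n :
    f i (op_exp_sum L w n) = series (fun k => k`!%:R^-1 * f i (iter k L w)) n.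
  rewrite real_linear_sum // /series /= big_mkord.
  by apply: eq_bigr => k _; rewrite real_linearZ.
have f_cvg i : cvgn (fun n => f i (op_exp_sum L w n)).
  under eq_fun do rewrite f_sum.
  have [K K0 KP] := Nphi _ (f_lin i).
  apply: normed_cvg.
  have : cvgn (series (fun k => K * N w * exp_coeff M k)).
    exact: is_cvg_seriesZ (is_cvg_series_exp_coeff M).
  apply: series_le_cvg => [k|k|k]; first exact: normr_ge0.
    by apply: mulr_ge0; [exact: mulr_ge0|exact: exp_coeff_ge0].
  rewrite /= normrM ger0_norm ?invr_ge0 // /exp_coeff /=.
  rewrite mulrC mulrA ler_wpM2r ?invr_ge0 //.
  apply: le_trans (KP _) _; rewrite -mulrA ler_wpM2l // mulrC; exact: NLk.
exists (\sum_i (limn (fun n => f i (op_exp_sum L w n)))%:C *: e i).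
move=> phi phi_lin.
rewrite real_linear_sum //.
under eq_fun do rewrite [op_exp_sum _ _ _]fE real_linear_sum //.
apply: cvgr_sum => i; rewrite real_linearZ //.
under eq_fun do rewrite real_linearZ //.
by apply: cvgMl; exact: f_cvg.
Qed.

End WeakConvergence.

(** * The Cauchy product of exponential series *)

(** Both sides run over the triangle [i + j < n], by antidiagonals and by rows. *)
Lemma sum_antidiagonals (U : zmodType) (F : nat -> nat -> U) n :
  \sum_(k < n) \sum_(i < k.+1) F i (k - i)%N =
  \sum_(i < n) \sum_(0 <= j < n - i) F i j.
Proof.
elim: n => [|n IH]; first by rewrite !big_ord0.
rewrite big_ord_recr /= IH.
have -> : \sum_(i < n.+1) \sum_(0 <= j < n.+1 - i) F i j =
    \sum_(i < n.+1) (\sum_(0 <= j < n - i) F i j + F i (n - i)%N).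
  by apply: eq_bigr => i _; rewrite subSn ?big_nat_recr // -ltnS.
by rewrite big_split /= [X in _ = X + _]big_ord_recr /= subnn big_geq // addr0.
Qed.

Lemma sum_square_sub_antidiagonals (U : zmodType) (F : nat -> nat -> U) n :
  \sum_(i < n) \sum_(0 <= j < n) F i j -
    \sum_(k < n) \sum_(i < k.+1) F i (k - i)%N =
  \sum_(i < n) \sum_(n - i <= j < n) F i j.
Proof.
rewrite sum_antidiagonals -sumrB; apply: eq_bigr => i _.
by rewrite (big_cat_nat _ (leq_subr i n)) //= addrAC subrr add0r.
Qed.

Lemma bin_div_fact (R : realType) k i : (i <= k)%N ->
  (k`!%:R^-1 : R) * 'C(k, i)%:R = i`!%:R^-1 * (k - i)`!%:R^-1.
Proof.
move=> ik; have nz m : (m`!%:R : R) != 0 by rewrite pnatr_eq0 -lt0n fact_gt0.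
have bz : ('C(k, i)%:R : R) != 0 by rewrite pnatr_eq0 -lt0n bin_gt0.
by rewrite -(bin_fact ik) !natrM; field; rewrite bz !nz.
Qed.

Section CauchyProduct.
Variables (R : realType) (W : vectType R[i]) (l r : {linear W -> W}).
Hypothesis lr_comm : forall w, r (l w) = l (r w).

(** The binomial theorem for two commuting operators; the induction step is Pascal's rule. *)
Lemma iter_add_comm k w : iter k (fun x => l x + r x) w =
  \sum_(i < k.+1) iter i l (iter (k - i) r w) *+ 'C(k, i).
Proof.
elim: k => [|k IH]; first by rewrite big_ord1.
have rl i x : r (iter i l x) = iter i l (r x).
  by elim: i => //= i <-; rewrite lr_comm.
rewrite iterS IH /= !linear_sum [RHS]big_ord_recl /= ?subn0 ?bin0 ?mulr1n.
under [X in _ = _ + X]eq_bigr => i _ do rewrite /bump /= add1n subSS binS mulrnDr.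
rewrite [X in _ = _ + X]big_split /= addrA [RHS]addrC; congr (_ + _).
  by apply: eq_bigr => i _; rewrite linearMn.
rewrite [LHS]big_ord_recl /= subn0 bin0 mulr1n; congr (_ + _).
rewrite [RHS]big_ord_recr /= bin_small // mulr0n addr0.
apply: eq_bigr => i _; rewrite /bump /= add1n linearMn /= lr_comm rl.
by rewrite -[r (iter _ r w)]iterS subnSK.
Qed.

Lemma op_exp_sum_add n w : op_exp_sum (fun x => l x + r x) w n =
  \sum_(k < n) \sum_(i < k.+1)
    (i`!%:R^-1 * (k - i)`!%:R^-1 : R)%:C *: iter i l (iter (k - i) r w).
Proof.
apply: eq_bigr => k _; rewrite iter_add_comm scaler_sumr; apply: eq_bigr => i _.
have ik : (i <= k)%N by rewrite -ltnS.
by rewrite -(bin_div_fact _ ik) rmorphM rmorph_nat -scalerA scaler_nat.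
Qed.

Lemma op_exp_sum_double n w : op_exp_sum l (op_exp_sum r w n) n =
  \sum_(i < n) \sum_(0 <= j < n)
    (i`!%:R^-1 * j`!%:R^-1 : R)%:C *: iter i l (iter j r w).
Proof.
apply: eq_bigr => i _; rewrite big_mkord /op_exp_sum.
have -> : iter i l (\sum_(k < n) (k`!%:R^-1 : R)%:C *: iter k r w) =
    \sum_(k < n) (k`!%:R^-1 : R)%:C *: iter i l (iter k r w).
  elim: (i : nat) => //= j ->; rewrite linear_sum; apply: eq_bigr => k _.
  by rewrite linearZ.
by rewrite scaler_sumr; apply: eq_bigr => j _; rewrite scalerA -rmorphM.
Qed.

(* The remainder is dominated termwise by the one in [expRD]. *)
Lemma op_exp_sum_mul_cvg w (phi : W -> R) : real_linear phi ->
  phi (op_exp_sum l (op_exp_sum r w n) n -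
       op_exp_sum (fun x => l x + r x) w n) @[n --> \oo] --> (0 : R).
Proof.
move=> phi_lin; have [N [N0 Nphi NL]] := dominating_size W.
have [K K0 phiK] := Nphi _ phi_lin.
have [M M0 /(iter_size_le M0) lM] := NL _ (linearP l).
have [M' M'0 /(iter_size_le M'0) rM'] := NL _ (linearP r).
pose g i j := exp_coeff M i * exp_coeff M' j.
(* The scalar Cauchy product for [M] and [M'] leaves the same corner [n <= i + j] of the square as
   remainder. *)
have seriesE n : series (exp_coeff M) n * series (exp_coeff M') n -
    series (exp_coeff (M + M')) n = \sum_(i < n) \sum_(n - i <= j < n) g i j.
  rewrite -sum_square_sub_antidiagonals; congr (_ - _).
    rewrite /series /= big_mkord mulr_suml.
    by apply: eq_bigr => i _; rewrite mulr_sumr.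
  rewrite /series /= big_mkord; apply: eq_bigr => k _.
  rewrite /exp_coeff /= addrC exprDn mulr_suml; apply: eq_bigr => i _.
  have ik : (i <= k)%N by rewrite -ltnS.
  rewrite /g /exp_coeff /= mulrnAl -mulrnAr -[_^-1 *+ _]mulr_natr.
  rewrite (bin_div_fact _ ik).
  by ring.
have bound n : `|phi (op_exp_sum l (op_exp_sum r w n) n -
       op_exp_sum (fun x => l x + r x) w n)| <=
    K * N w * (series (exp_coeff M) n * series (exp_coeff M') n -
               series (exp_coeff (M + M')) n).
  rewrite op_exp_sum_double op_exp_sum_add.
  rewrite (sum_square_sub_antidiagonals (fun i j =>
    (i`!%:R^-1 * j`!%:R^-1 : R)%:C *: iter i l (iter j r w))) seriesE.
  rewrite real_linear_sum // mulr_sumr; apply: le_trans (ler_norm_sum _ _ _) _.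
  apply: ler_sum => i _; rewrite real_linear_sum // mulr_sumr.
  apply: le_trans (ler_norm_sum _ _ _) _; apply: ler_sum => j _.
  rewrite real_linearZ // normrM ger0_norm ?mulr_ge0 ?invr_ge0 //.
  have -> : K * N w * g i j =
      i`!%:R^-1 * j`!%:R^-1 * (K * (M ^+ i * (M' ^+ j * N w))).
    by rewrite /g /exp_coeff /=; ring.
  rewrite ler_wpM2l ?mulr_ge0 ?invr_ge0 //.
  apply: le_trans (phiK _) _; rewrite ler_wpM2l //.
  by apply: le_trans (lM _ _) _; apply: ler_wpM2l; [exact: exprn_ge0|exact: rM'].
have lim0 : K * N w * (series (exp_coeff M) n * series (exp_coeff M') n -
               series (exp_coeff (M + M')) n) @[n --> \oo] --> (0 : R).
  have -> : (0 : R) = K * N w * (expR M * expR M' - expR (M + M')).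
    by rewrite expRD subrr mulr0.
  apply: cvgMr; apply: cvgB; last exact: is_cvg_series_exp_coeff.
  by apply: cvgM; exact: is_cvg_series_exp_coeff.
apply/cvgr0Pnorm_le => eps eps0.
move/cvgr0Pnorm_le: lim0 => /(_ _ eps0); apply: filterS => n.
by apply: le_trans; apply: le_trans (bound n) (ler_norm _).
Qed.

End CauchyProduct.

(** * Uniqueness of power series coefficients *)

(** Strong induction on [k]: when the lower coefficients vanish, dividing the series by [t ^+ k] and
    letting [t] tend to 0 isolates [a k]. *)
Lemma power_series_eq0 (R : realType) (a : nat -> R) (B : R) :
  (forall n, \sum_(k < n) `|a k| <= B) ->
  (forall t : R, \sum_(k < n) t ^+ k * a k @[n --> \oo] --> (0 : R)) ->
  forall k, a k = 0.
Proof.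
move=> aB at0 k.
have B0 : 0 <= B by have := aB 0%N; rewrite big_ord0.
elim/ltn_ind: k => k IH.
(* The terms of index above [k] carry a factor at most [t ^+ k.+1], because [t <= 1]. *)
have small t : 0 < t -> t <= 1 -> `|a k| <= t * B.
  move=> t0 t1; rewrite -(ler_pM2l (exprn_gt0 k t0)) mulrA -exprSr.
  apply/ler_addgt0Pr => eps eps0.
  have /cvgr0Pnorm_le/(_ _ eps0)[m _ mP] := at0 t.
  (* Large enough for the partial sum to be within [eps] of 0 and to contain the term of index
     [k]. *)
  pose n := maxn m k.+1; have kn : (k < n)%N by rewrite leq_max ltnSn orbT.
  have := mP n (leq_maxl _ _); rewrite /= => sum_le.
  rewrite addrC -{1}(ger0_norm (exprn_ge0 k (ltW t0))) -normrM.
  have -> : t ^+ k * a k = \sum_(j < n) t ^+ j * a j -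
      \sum_(j < n | j != Ordinal kn) t ^+ j * a j.
    by rewrite (bigD1 (Ordinal kn)) //= addrK.
  apply: le_trans (ler_normB _ _) _; apply: lerD => //.
  apply: le_trans (ler_norm_sum _ _ _) _.
  apply: le_trans (_ : \sum_(j < n) t ^+ k.+1 * `|a j| <= _); last first.
    by rewrite -mulr_sumr ler_wpM2l // exprn_ge0 // ltW.
  rewrite [leRHS](bigD1 (Ordinal kn)) //= -[leLHS]add0r; apply: lerD.
    by rewrite mulr_ge0 // exprn_ge0 // ltW.
  apply: ler_sum => j jk.
  have [jk'|kj|jk'] := ltngtP j k.
  - by rewrite IH // normr0 mulr0 mulr0 normr0.
  - rewrite normrM ger0_norm ?exprn_ge0 ?(ltW t0) // ler_wpM2r //.
    by apply: ler_wiXn2l => //; exact: ltW.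
  - by case/negP: jk; apply/eqP/val_inj.
apply/eqP; rewrite -normr_le0; apply/ler_addgt0Pr => eps eps0; rewrite add0r.
have B1 : 0 < B + 1 by rewrite ltr_wpDl.
(* The minimum makes [small] applicable; [B + 1] replaces [B], which may be zero, as divisor. *)
pose t := Num.min 1 (eps / (B + 1)).
have t0 : 0 < t by rewrite lt_min ltr01 divr_gt0.
apply: le_trans (small t t0 _) _; first by rewrite ge_min lexx.
have tle : t <= eps / (B + 1) by rewrite ge_min lexx orbT.
apply: le_trans (ler_wpM2r B0 tle) _.
by rewrite -mulrA ler_piMr ?(ltW eps0) // mulrC ler_pdivrMr // mul1r lerDl.
Qed.

(** * Algebra of the commutator *)

Section Commutator.
Variables (R : realType) (V : vectType R[i]).
Implicit Types A B X Z : 'End(V).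

Lemma commutatorE A B v : commutator A B v = A (B v) - B (A v).
Proof. by rewrite /commutator !lfunE /= !lfunE /= !lfunE. Qed.

Lemma commutator_linear X : linear (commutator X).
Proof.
move=> c A B; apply/lfunP => v.
rewrite [RHS]add_lfunE [X in _ = X + _]scale_lfunE !commutatorE.
rewrite !add_lfunE !scale_lfunE linearP.
by rewrite scalerBr opprD addrACA.
Qed.

Lemma commutatorPl (c : R[i]) X Z A :
  commutator (X + c *: Z) A = commutator X A + c *: commutator Z A.
Proof.
apply/lfunP => v.
rewrite [RHS]add_lfunE [X in _ = _ + X]scale_lfunE !commutatorE.
rewrite !add_lfunE !scale_lfunE.
by rewrite linearD linearZ scalerBr opprD addrACA.
Qed.

Lemma commutator_jacobi A B X : commutator A (commutator B X) =
  commutator B (commutator A X) + commutator (commutator A B) X.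
Proof.
apply/lfunP => v; rewrite [RHS]add_lfunE !commutatorE !linearB /=.
set a := A (B (X v)); set b := A (X (B v)); set c := B (X (A v)).
set d := X (B (A v)); set e := B (A (X v)); set f := X (A (B v)).
rewrite -!opprD.
have -> : e - c - (b - f) + (a - e - (f - d)) = a - c - (b - d).
  rewrite addrACA; congr (_ + _); first by rewrite addrC addrA subrK.
  by rewrite -opprD addrA subrK.
by rewrite !opprB addrACA [RHS]addrACA [- b - c]addrC.
Qed.

End Commutator.

(** * Commutator words *)

Section CommutatorWords.
Variables (R : realType) (V : vectType R[i]).
Variables (g : set 'End(V)) (H : 'End(V)) (phi : 'End(V) -> R).
Hypotheses (g_lie : real_lie_algebra g) (phi_lin : real_linear phi).
Implicit Types (s w : seq 'End(V)) (X Z : 'End(V)).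

Let m s := phi (foldr (@commutator R V) H s).

Lemma foldr_commutator_linear s : linear (fun A => foldr (@commutator R V) A s).
Proof.
elim: s => [|X s IH] c A B //=.
by rewrite IH commutator_linear.
Qed.

Lemma word_addl w X Z (t : R) s :
  m (w ++ (X + t%:C *: Z) :: s) = m (w ++ X :: s) + t * m (w ++ Z :: s).
Proof.
rewrite /m !foldr_cat /= commutatorPl addrC foldr_commutator_linear.
by rewrite phi_lin addrC.
Qed.

(** By the Jacobi identity, exchanging two adjacent letters costs only a word with one letter
    fewer. *)
Lemma word_swap w X Z s :
  m (w ++ X :: Z :: s) = m (w ++ Z :: X :: s) + m (w ++ commutator X Z :: s).
Proof.
rewrite /m !foldr_cat /= commutator_jacobi -[X in foldr _ (X + _) _]scale1r.
by rewrite foldr_commutator_linear scale1r real_linearD.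
Qed.

(** Multilinearity in the letters: splitting the first letter [X + t%:C *: Z] gives [p + 'X * q].
    The constant coefficient is recorded because that of [q] enters the linear coefficient at the
    next step. *)
Lemma word_polarization r w X Z : exists p : {poly R},
  [/\ forall t, p.[t] = m (w ++ nseq r (X + t%:C *: Z)),
      p`_0 = m (w ++ nseq r X) &
      p`_1 = \sum_(i < r) m (w ++ nseq i X ++ Z :: nseq (r.-1 - i) X)].
Proof.
elim: r w => [|r IH] w.
  exists (m w)%:P; split => [t||]; rewrite ?hornerC ?coefC ?cats0 //=.
  by rewrite big_ord0.
have [p [p_t p_0 p_1]] := IH (rcons w X).
have [q [q_t q_0 q_1]] := IH (rcons w Z).
exists (p + 'X * q); split => [t||].
- by rewrite hornerD hornerM hornerX p_t q_t !cat_rcons /= word_addl.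
- by rewrite coefD coefXM p_0 cat_rcons addr0.
- rewrite coefD coefXM /= q_0 p_1 big_ord_recl /= subn0 cat_rcons addrC.
  congr (_ + _); apply: eq_bigr => i _; rewrite cat_rcons /bump /= add1n.
  by rewrite -subn1 -subnDA add1n.
Qed.

Lemma poly_values_eq0 (p : {poly R}) : (forall t, p.[t] = 0) -> p = 0.
Proof.
move=> p0; apply/eqP/negPn/negP => pn0.
(* The naturals below [size p] are distinct in [R] and give one root more than the degree allows. *)
pose rs := [seq k%:R : R | k <- iota 0 (size p)].
suff : (size rs < size p)%N by rewrite size_map size_iota ltnn.
apply: max_poly_roots pn0 _ _; first by apply/allP => x _; rewrite /root p0.
by rewrite map_inj_uniq ?iota_uniq // => i j /eqP; rewrite eqr_nat => /eqP.
Qed.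

Hypothesis powers0 : forall X k, g X -> m (nseq k X) = 0.

(** The outer induction on the length disposes of shorter words, which makes the value symmetric in
    the letters. The inner one, on the number of free letters before a block of equal ones, is the
    polarization. *)
Lemma words0 s : (forall X, X \in s -> g X) -> m s = 0.
Proof.
have [g0 gD gZ gC] := g_lie.
have [n] := ubnP (size s); elim: n s => // n IH s; rewrite ltnS leq_eqVlt.
case/predU1P => [sz|/IH //].
case: n => [|n] in IH sz *; first by case: s sz => // _ _; exact: (powers0 0 g0).
have gnseq k X : g X -> forall Y, Y \in nseq k X -> g Y.
  by move=> gX Y /nseqP[->].
have gcat s1 s2 : (forall X, X \in s1 -> g X) -> (forall X, X \in s2 -> g X) ->
    forall X, X \in s1 ++ s2 -> g X.
  by move=> g1 g2 X; rewrite mem_cat => /orP[/g1|/g2].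
have gcons X s1 : g X -> (forall Y, Y \in s1 -> g Y) ->
    forall Y, Y \in X :: s1 -> g Y.
  by move=> gX g1 Y; rewrite in_cons => /predU1P[->|/g1].
(* Modulo shorter words, the letters commute. *)
have move_front w X Z i r : (forall Y, Y \in w -> g Y) -> g X -> g Z ->
    (size w + (i + r) = n)%N ->
    m (w ++ nseq i X ++ Z :: nseq r X) = m (w ++ Z :: nseq (i + r) X).
  move=> gw gX gZ'; elim: i w gw => [//|i IHi] w gw szw.
  rewrite [nseq i.+1 X]/= cat_cons -cat_rcons IHi; last 2 first.
  - by move=> Y; rewrite mem_rcons => /(gcons _ _ gX gw).
  - by rewrite size_rcons -szw; lia.
  rewrite cat_rcons word_swap addSn [X in _ + X]IH ?addr0 //.
    by rewrite size_cat /= size_nseq; lia.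
  by apply: gcat => //; apply: gcons; [exact: gC|exact: gnseq].
(* Here [j] free letters precede [r] equal ones: [j = 0] is the hypothesis on powers, and [r = 0] is
   an arbitrary word, the letter [0] then filling an empty block. *)
suff Q j r w X : (size w = j)%N -> (j + r = n.+1)%N ->
    (forall Y, Y \in w -> g Y) -> g X -> m (w ++ nseq r X) = 0.
  move=> gs; rewrite -[s]cats0.
  by apply: (Q n.+1 0%N s 0); rewrite ?addn0.
elim: j r w X => [|j IHj] r w X szw jr gw gX.
  by case: w szw {gw} => // _; exact: powers0.
case: (lastP w) szw gw => // w' Z; rewrite size_rcons => -[szw] gw.
have gZ' : g Z by apply: gw; rewrite mem_rcons mem_head.
have gw' Y : Y \in w' -> g Y.
  by move=> Yw; apply: gw; rewrite mem_rcons in_cons Yw orbT.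
(* Moving [Z] into the block leaves one free letter fewer, so [p] vanishes at every [t]. By symmetry
   its linear coefficient is [r.+1] times the wanted value. *)
have [p [p_t _ p_1]] := word_polarization r.+1 w' X Z.
have p0 : p = 0.
  apply: poly_values_eq0 => t; rewrite p_t; apply: IHj => //; first by lia.
  by apply: gD => //; exact: gZ.
move: p_1; rewrite p0 coef0 cat_rcons.
under eq_bigr => i _.
  have ir : (i <= r)%N by rewrite -ltnS.
  rewrite move_front //=; last by rewrite subnKC //; lia.
  rewrite subnKC //; over.
rewrite sumr_const card_ord => /esym/eqP.
by rewrite mulrn_eq0 /= => /eqP.
Qed.

End CommutatorWords.

(** * Operator exponentials *)

Section Exponential.
Variables (R : realType) (V : vectType R[i]) (form : {dot V for conjC}).
Implicit Types (A B E H X : 'End(V)).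

(** The real inner product underlying [form]; fixing one argument gives a functional against which
    weak convergence can be tested. *)
Definition re_form u v : R := complex.Re (form u v).

Lemma re_form_real_linearl v : real_linear (re_form^~ v).
Proof.
move=> c x y; rewrite /re_form linearDl linearZl_LR /=.
by case: (form x v) (form y v) => [? ?] [? ?] /=; rewrite mul0r subr0.
Qed.

Lemma re_form_real_linearr u : real_linear (re_form u).
Proof.
move=> c x y; rewrite /re_form linearDr linearZr_LR /=.
by case: (form u x) (form u y) => [? ?] [? ?] /=; rewrite oppr0 mul0r subr0.
Qed.

Lemma form_self u : form u u = (re_form u u)%:C.
Proof. by rewrite /re_form RRe_real // ger0_real ?dnorm_ge0. Qed.

Lemma re_form_ge0 u : 0 <= re_form u u.
Proof. by rewrite -ler0c -form_self dnorm_ge0. Qed.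

Lemma re_form_eq0 u : re_form u u = 0 -> u = 0.
Proof. by move=> u0; apply/eqP; rewrite -(dnorm_eq0 form) form_self u0. Qed.

Lemma re_form_le u v : `|re_form u v| <= hnorm form u * hnorm form v.
Proof.
rewrite /hnorm -sqrtrM ?re_form_ge0 // -sqrtr_sqr ler_sqrt ?mulr_ge0 ?re_form_ge0 //.
have [+ _] := CauchySchwarz form u v.
rewrite -add_Re2_Im2 !form_self -rmorphM /= lecR; apply: le_trans.
by rewrite lerDl sqr_ge0.
Qed.

(** The imaginary part at [u] is read off from the real part at ['i *: u]. *)
Lemma form_re_ext (f h : V -> R[i]) : scalar f -> scalar h ->
  (forall u, complex.Re (f u) = complex.Re (h u)) -> f =1 h.
Proof.
move=> f_lin h_lin fh u; apply/eqP; rewrite eq_complex fh eqxx /=.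
have scal (k : V -> R[i]) : scalar k -> k ('i *: u) = 'i * k u.
  move=> k_lin; have k0 : k 0 = 0.
    by have /eqP := k_lin 1 0 0; rewrite scaler0 addr0 mul1r -subr_eq subrr => /eqP.
  by have := k_lin 'i u 0; rewrite !addr0 k0 addr0.
have := fh ('i *: u); rewrite !scal //.
by case: (f u) (h u) => [? ?] [? ?] /=; rewrite !mul0r !mul1r !sub0r => /oppr_inj ->.
Qed.

Lemma adjoint_unique A B B' :
  is_adjoint form A B -> is_adjoint form A B' -> B = B'.
Proof.
move=> AB AB'; apply/lfunP => v; apply/eqP; rewrite -subr_eq0.
by apply/eqP/re_form_eq0; rewrite /re_form linearBr /= -AB -AB' subrr.
Qed.

(** The squared norm is a real-bilinear form evaluated on the diagonal, so it tends to 0 along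
    [u n - l]. *)
Lemma weak_cvg_hnorm (u : nat -> V) l :
  weak_cvg u l -> hnorm form (u n - l) @[n --> \oo] --> (0 : R).
Proof.
move=> ul; have ul0 : weak_cvg (fun n => u n - l) 0.
  move=> phi phi_lin; rewrite real_linear0 // -(subrr (phi l)).
  by under eq_fun do rewrite real_linearB //; apply: cvgB; [exact: ul|exact: cvg_cst].
rewrite -[X in _ --> X]sqrtr0.
apply: continuous_cvg; first exact: sqrt_continuous.
rewrite -(real_linear0 (re_form_real_linearr 0)).
by apply: (cvg_real_bilinear _ _ ul0 ul0);
  [exact: re_form_real_linearl|exact: re_form_real_linearr].
Qed.

(** By Cauchy-Schwarz, norm convergence passes to inner products with a fixed vector; testing
    against [l - l'] shows that this vector is orthogonal to itself. *)
Lemma hnorm_cvg_unique (u : nat -> V) l l' :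
  hnorm form (u n - l) @[n --> \oo] --> (0 : R) ->
  hnorm form (u n - l') @[n --> \oo] --> (0 : R) -> l = l'.
Proof.
have cvg_re k w : hnorm form (u n - k) @[n --> \oo] --> (0 : R) ->
    re_form (u n - k) w @[n --> \oo] --> (0 : R).
  move=> uk; have : hnorm form (u n - k) * hnorm form w @[n --> \oo] --> (0 : R).
    by rewrite -(mul0r (hnorm form w)); apply: cvgMl.
  move=> /cvgr0Pnorm_le lim0; apply/cvgr0Pnorm_le => eps /lim0.
  apply: filterS => n; apply: le_trans.
  by apply: le_trans (re_form_le _ _) (ler_norm _).
move=> ul ul'; apply/eqP; rewrite -subr_eq0; apply/eqP/re_form_eq0.
have := cvgB (cvg_re _ (l - l') ul') (cvg_re _ (l - l') ul); rewrite subrr => lim0.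
have diff n : re_form (u n - l') (l - l') - re_form (u n - l) (l - l') =
    re_form (l - l') (l - l').
  rewrite -(real_linearB (re_form_real_linearl (l - l'))).
  by rewrite opprB addrC addrA subrK.
have {}lim0 : (fun=> re_form (l - l') (l - l')) n @[n --> \oo] --> (0 : R).
  by rewrite (eq_cvg _ _ (fun n => esym (diff n))); exact: lim0.
exact: (cvg_unique (@Rhausdorff R) (cvg_cst _) lim0).
Qed.

Definition lmul X A := (X \o A)%VF.
Definition rmul X A := (A \o X)%VF.

Lemma lmul_linear X : linear (lmul X).
Proof. by move=> c A B; rewrite /lmul comp_lfunDr comp_lfunZr. Qed.

Lemma rmul_linear X : linear (rmul X).
Proof. by move=> c A B; rewrite /rmul comp_lfunDl comp_lfunZl. Qed.

HB.instance Definition _ X := GRing.isLinear.Build _ _ _ _ (lmul X) (lmul_linear X).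
HB.instance Definition _ X := GRing.isLinear.Build _ _ _ _ (rmul X) (rmul_linear X).

Lemma exp_partial_sumE X : exp_partial_sum X = op_exp_sum (lmul X) \1%VF.
Proof.
apply/funext => n; apply: eq_bigr => k _.
by rewrite fmorphV rmorph_nat.
Qed.

Lemma weak_cvg_is_exp X E : weak_cvg (exp_partial_sum X) E -> is_exp form X E.
Proof.
move=> XE v; apply: (weak_cvg_hnorm (u := fun n => exp_partial_sum X n v)).
apply: (weak_cvg_comp (f := fun A : 'End(V) => A v)) XE.
by move=> c A B; rewrite add_lfunE scale_lfunE.
Qed.

Lemma exp_weak_cvg X : exists E, weak_cvg (exp_partial_sum X) E.
Proof. by rewrite exp_partial_sumE; apply: op_exp_sum_cvg; exact: linearP. Qed.

(** A weak limit exists and is also a pointwise limit in norm, so uniqueness of norm limits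
    identifies it with [E]. *)
Lemma is_exp_weak_cvg X E : is_exp form X E -> weak_cvg (exp_partial_sum X) E.
Proof.
have [E' XE'] := exp_weak_cvg X; move=> XE.
suff -> : E = E' by [].
apply/lfunP => v; apply: hnorm_cvg_unique (XE v) _.
exact: weak_cvg_is_exp XE' v.
Qed.

Lemma iter_lmul_comm k X :
  (iter k (lmul X) \1%VF \o X)%VF = (X \o iter k (lmul X) \1%VF)%VF.
Proof.
elim: k => [|k IH] /=; first by rewrite comp_lfun1l comp_lfun1r.
by rewrite {1}/lmul -comp_lfunA IH.
Qed.

Lemma exp_partial_sum_adjoint X n : skew_hermitian_op form X ->
  is_adjoint form (exp_partial_sum X n) (exp_partial_sum (- X) n).
Proof.
move=> skewX u v; rewrite !exp_partial_sumE /op_exp_sum !sum_lfunE.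
rewrite linear_sumlz linear_sumr; apply: eq_bigr => k _.
rewrite !scale_lfunE linearZl_LR linearZr_LR /=.
congr (_ * _); first exact/esym/conjc_real.
elim: (k : nat) u v => {k} [|k IH] u v /=; first by rewrite !id_lfunE.
by rewrite {1}/lmul comp_lfunE skewX IH -comp_lfunE iter_lmul_comm.
Qed.

Lemma exp_adjoint X E E' : skew_hermitian_op form X ->
  weak_cvg (exp_partial_sum X) E -> weak_cvg (exp_partial_sum (- X)) E' ->
  is_adjoint form E E'.
Proof.
move=> skewX XE XE' u v; move: u.
(* Weak limits are tested on real functionals only; since both sides are linear in [u], equality of
   real parts is enough. *)
apply: form_re_ext => [c x y|c x y|u].
- by rewrite linearP linearDl linearZl_LR.
- by rewrite linearDl linearZl_LR.
have eval w : linear (fun A : 'End(V) => A w).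
  by move=> c A B; rewrite add_lfunE scale_lfunE.
have Eu := weak_cvg_comp (eval u) XE.
have E'v := weak_cvg_comp (eval v) XE'.
have := E'v _ (re_form_real_linearr u).
have <- : (fun n => re_form (exp_partial_sum X n u) v) =
    (fun n => re_form u (exp_partial_sum (- X) n v)).
  by apply/funext => n; rewrite /re_form exp_partial_sum_adjoint.
exact: (cvg_unique (@Rhausdorff R) (Eu _ (re_form_real_linearl v))).
Qed.

Lemma iter_rmul k X H : iter k (rmul X) H = (H \o iter k (lmul X) \1%VF)%VF.
Proof.
elim: k => [|k IH] /=; first by rewrite comp_lfun1r.
by rewrite IH /rmul -comp_lfunA iter_lmul_comm.
Qed.

Lemma iter_lmul k X A : iter k (lmul X) A = (iter k (lmul X) \1%VF \o A)%VF.
Proof.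
elim: k => [|k IH] /=; first by rewrite comp_lfun1l.
by rewrite IH /lmul comp_lfunA.
Qed.

(** [commutator (- X)] is the sum of [lmul (- X)] and [rmul X], which commute. The product of their
    exponential sums at [H] is the partial sum of [e^-X], times [H], times that of [e^X], and the
    Cauchy product remainder tends to 0. *)
Lemma exp_conjugation_series X H E E' :
  weak_cvg (exp_partial_sum X) E -> weak_cvg (exp_partial_sum (- X)) E' ->
  weak_cvg (op_exp_sum (commutator (- X)) H) (E' \o (H \o E))%VF.
Proof.
move=> XE XE' phi phi_lin.
have -> : commutator (- X) = fun A => lmul (- X) A + rmul X A.
  apply/funext => A; rewrite /commutator /lmul /rmul; congr (_ + _).
  by rewrite comp_lfunNr opprK.
have sandwich n : op_exp_sum (lmul (- X)) (op_exp_sum (rmul X) H n) n =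
    (exp_partial_sum (- X) n \o (H \o exp_partial_sum X n))%VF.
  rewrite !exp_partial_sumE.
  have -> : op_exp_sum (rmul X) H n = (H \o op_exp_sum (lmul X) \1%VF n)%VF.
    rewrite -[RHS]/(lmul H _) linear_sum; apply: eq_bigr => k _.
    by rewrite iter_rmul linearZ.
  set A := (H \o _)%VF.
  rewrite -[RHS]/(rmul A _) linear_sum; apply: eq_bigr => k _.
  by rewrite iter_lmul linearZ.
have prod_cvg : weak_cvg
    (fun n => (exp_partial_sum (- X) n \o (H \o exp_partial_sum X n))%VF)
    (E' \o (H \o E))%VF.
  apply: (weak_cvg_bilinear (B := fun A B => (A \o (H \o B))%VF) _ _ XE' XE).
    by move=> B c A A'; exact: rmul_linear.
  move=> A c B B'; rewrite -!/(lmul _ _).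
  by rewrite linearP linearP.
have comm w : rmul X (lmul (- X) w) = lmul (- X) (rmul X w).
  by rewrite /rmul /lmul comp_lfunA.
have lim := cvgB (prod_cvg _ phi_lin) (op_exp_sum_mul_cvg comm H phi_lin).
rewrite subr0 in lim.
have diff n : phi (op_exp_sum (fun A => lmul (- X) A + rmul X A) H n) =
    phi (exp_partial_sum (- X) n \o (H \o exp_partial_sum X n))%VF -
    phi (op_exp_sum (lmul (- X)) (op_exp_sum (rmul X) H n) n -
         op_exp_sum (fun A => lmul (- X) A + rmul X A) H n).
  by rewrite sandwich real_linearB // opprB addrC subrK.
by rewrite (eq_cvg _ _ diff); exact: lim.
Qed.

End Exponential.

(** * The two inclusions *)

Section SpanEquality.
Variables (R : realType) (V : vectType R[i]) (form : {dot V for conjC}).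
Variables (g : set 'End(V)) (H : 'End(V)).
Hypotheses (g_lie : real_lie_algebra g)
  (g_skew : forall X, g X -> skew_hermitian_op form X).

Lemma foldr_commutator_nseq k X :
  foldr (@commutator R V) H (nseq k X) = iter k (commutator X) H.
Proof. by elim: k => //= k ->. Qed.

Lemma iter_commutatorZ (t : R[i]) k X :
  iter k (commutator (t *: X)) H = t ^+ k *: iter k (commutator X) H.
Proof.
have comml A : commutator (t *: X) A = t *: commutator X A.
  by rewrite /commutator scalerBr comp_lfunZl comp_lfunZr.
have commr c A : commutator X (c *: A) = c *: commutator X A.
  by rewrite /commutator scalerBr comp_lfunZr comp_lfunZl.
elim: k => [|k IH] /=; first by rewrite expr0 scale1r.
by rewrite IH comml commr scalerA exprS.
Qed.

Lemma lie_opp X : g X -> g (- X).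
Proof.
case: g_lie => _ _ gZ _ gX; rewrite -scaleN1r -(rmorph1 (real_complex R)) -rmorphN.
exact: gZ.
Qed.

(** Adjoints are unique, so [Udag] is the exponential of [- X] and the conjugation series
    applies. *)
Lemma orbit_generator_cvg X U Udag (phi : 'End(V) -> R) : g X ->
  is_exp form X U -> is_adjoint form U Udag -> real_linear phi ->
  phi (op_exp_sum (commutator (- X)) H n) @[n --> \oo] -->
    phi (Udag \o (H \o U))%VF.
Proof.
move=> gX XU UUdag phi_lin; have XU' := is_exp_weak_cvg XU.
have [E' XE'] := exp_weak_cvg (- X).
rewrite (adjoint_unique UUdag (exp_adjoint (g_skew gX) XU' XE')).
exact: exp_conjugation_series XU' XE' _ phi_lin.
Qed.

Lemma orbit_sub_commutator : orbit_space form g H `<=` commutator_space g H.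
Proof.
move=> x xO; apply: real_span_separation => phi phi_lin phi0.
apply: (real_linear_span phi_lin _ xO) => _ [U [Udag [[X gX XU] UUdag ->]]].
have := orbit_generator_cvg gX XU UUdag phi_lin.
(* Every term is a real multiple of a word in the single letter [- X], so the limit is one of
   zeros. *)
have phi_sum0 n : phi (op_exp_sum (commutator (- X)) H n) = 0.
  rewrite real_linear_sum // big1 // => k _; rewrite real_linearZ //.
  rewrite -foldr_commutator_nseq phi0 ?mulr0 //; exists (nseq k (- X)) => //=.
  by move=> Y /nseqP[-> _]; exact: lie_opp.
rewrite (eq_cvg _ _ phi_sum0) => lim.
exact: (cvg_unique (@Rhausdorff R) lim (cvg_cst _)).
Qed.

Lemma commutator_sub_orbit : commutator_space g H `<=` orbit_space form g H.
Proof.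
move=> x xC; apply: real_span_separation => phi phi_lin phi0.
apply: (real_linear_span phi_lin _ xC) => _ [s gs <-].
apply: (words0 g_lie phi_lin) gs => X k gX; rewrite foldr_commutator_nseq.
(* The coefficients in [t] of [phi] at [e^(tX) H e^(-tX)]. *)
pose a k := k`!%:R^-1 * phi (iter k (commutator X) H).
suff /(_ k)/eqP : forall k, a k = 0.
  by rewrite mulf_eq0 invr_eq0 pnatr_eq0 -leqn0 leqNgt fact_gt0 => /eqP.
have [N [N0 Nphi NL]] := dominating_size 'End(V).
have [K K0 phiK] := Nphi _ phi_lin.
have [M M0 /(iter_size_le M0) LM] := NL _ (commutator_linear X).
(* With [M] a bound for [commutator X], the real exponential series at [M] bounds the sums of the
   absolute values of the coefficients. *)
apply: (power_series_eq0 (B := K * N H * expR M)) => [n|t].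
  have sM : series (exp_coeff M) n <= expR M.
    apply: nondecreasing_cvgn_le (is_cvg_series_exp_coeff M) n.
    by apply: nondecreasing_series => k' _ _; exact: exp_coeff_ge0.
  apply: le_trans (_ : K * N H * series (exp_coeff M) n <= _); last first.
    by rewrite ler_wpM2l // mulr_ge0.
  rewrite /series /= big_mkord mulr_sumr; apply: ler_sum => j _.
  rewrite normrM ger0_norm ?invr_ge0 // mulrC /exp_coeff /=.
  rewrite mulrA ler_wpM2r ?invr_ge0 //.
  apply: le_trans (phiK _) _; rewrite -mulrA ler_wpM2l // mulrC; exact: LM.
have [_ _ gZ _] := g_lie.
(* The sign makes [commutator (- Y)] equal to [t] times [commutator X]. *)
have gtX := gZ (- t) _ gX; set Y := (- t)%:C *: X in gtX.
have [U YU] := exp_weak_cvg Y; have [Udag YUdag] := exp_weak_cvg (- Y).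
have YexpU := weak_cvg_is_exp form YU.
have UUdag := exp_adjoint (g_skew gtX) YU YUdag.
have := orbit_generator_cvg gtX YexpU UUdag phi_lin.
rewrite phi0; last by exists U, Udag; split => //; exists Y.
have seriesE n : phi (op_exp_sum (commutator (- Y)) H n) =
    \sum_(j < n) t ^+ j * a j.
  rewrite real_linear_sum //; apply: eq_bigr => j _.
  have -> : - Y = t%:C *: X by rewrite /Y rmorphN scaleNr opprK.
  rewrite iter_commutatorZ -rmorphXn !real_linearZ //.
  by rewrite /a mulrCA.
by rewrite (eq_cvg _ _ seriesE).
Qed.

End SpanEquality.

Theorem theoremC1 (R : realType) (V : vectType R[i]%C)
  (form : {dot V for @Num.conj R[i]%C}%R)
  (g_pri : set 'End(V)) (H_pert : 'End(V))
  (g_lie : real_lie_algebra g_pri)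
  (g_skew : forall X : 'End(V), g_pri X -> skew_hermitian_op form X)
  (H_herm : hermitian_op form H_pert) :
  commutator_space g_pri H_pert = orbit_space form g_pri H_pert.
Proof.
apply/seteqP; split; first exact: commutator_sub_orbit.
exact: orbit_sub_commutator.
Qed.
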